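(* Let $\Gamma=\langle a,b,c\rangle\le\mathrm{Aut}(X^* )$ be the Hanoi towers group and $\Gamma'$ its commutator subgroup. For all $n\ge1$, $\mathrm{Rist}_\Gamma(n)=X^n*\Gamma'$.
   Context: Let $X=\{1,2,3\}$ and let $X^*$ be the infinite rooted ternary tree: its vertices are the finite words over $X$, the root is the empty word $\varnothing$, and each word $w$ is joined to $wx$ for $x\in X$. The level $|u|$ of a vertex $u$ is its length. $\mathrm{Aut}(X^* )$ is the group of root-preserving, edge-preserving bijections of the vertex set; it acts on the right, $u\mapsto u^g$. For $g\in\mathrm{Aut}(X^* )$ and a vertex $u$, the state $g@u\in\mathrm{Aut}(X^* )$ is the automorphism determined by $(uw)^g=u^g\,w^{g@u}$ for all words $w$. One writes $g=(g_1,g_2,g_3)\sigma$ when $g_i=g@i$ for $i\in X$ and $\sigma\in S_3$ is the permutation by which $g$ acts on the first level $X$. The Hanoi towers group is $\Gamma=\langle a,b,c\rangle$, where $a,b,c\in\mathrm{Aut}(X^* )$ are defined recursively by $a=(a,1,1)\sigma_{23}$, $b=(1,b,1)\sigma_{13}$, $c=(1,1,c)\sigma_{12}$, with $\sigma_{ij}$ the transposition of $i$ and $j$. For $G\le\mathrm{Aut}(X^* )$ and a vertex $u$, $\mathrm{Rist}_G(u)$ is the subgroup of elements of $G$ acting trivially outside the subtree of words with prefix $u$, and $\mathrm{Rist}_G(n)=\langle\mathrm{Rist}_G(u):|u|=n\rangle=\prod_{|u|=n}\mathrm{Rist}_G(u)$. For a vertex $u$ and $g\in\mathrm{Aut}(X^*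 )$, $u*g$ is the automorphism with $(uw)^{u*g}=u\,w^g$ for all words $w$ and $v^{u*g}=v$ if $u$ is not a prefix of $v$. For $K\le\mathrm{Aut}(X^* )$, $u*K=\{u*k:k\in K\}$ and $X^n*K=\prod_{|u|=n}u*K$ (internal direct product over the vertices of level $n$). *)

(* Defs.v *)
From HB Require Import structures.
From mathcomp Require Import all_boot all_fingroup.
From mathcomp Require Import boolp classical_sets.

Set Implicit Arguments.
Unset Strict Implicit.
Unset Printing Implicit Defensive.

Local Open Scope classical_set_scope.
Local Open Scope group_scope.

(* The letters 1, 2, 3 are the elements 0, 1, 2 of 'I_3. *)
Definition X := 'I_3.
Definition x1 : X := @Ordinal 3 0 isT.
Definition x2 : X := @Ordinal 3 1 isT.
Definition x3 : X := @Ordinal 3 2 isT.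

Definition word := seq X.

Definition edge : rel word := fun u v =>
  [exists x, v == rcons u x] || [exists x, u == rcons v x].

Definition is_aut (f : word -> word) :=
  [/\ bijective f, f [::] = [::] & {mono f : u v / edge u v}].

(* The application [g u] is the right action u^g. *)
Record aut := Aut { aut_fun :> word -> word; aut_funP : is_aut aut_fun }.

Lemma autP (g h : aut) : g =1 h <-> g = h.
Proof.
split=> [/funext|->//]; case: g h => [g gP] [h hP] /= E.
by move: gP hP; rewrite E => gP hP; congr Aut; exact: Prop_irrelevance.
Qed.

HB.instance Definition _ := gen_eqMixin aut.
HB.instance Definition _ := gen_choiceMixin aut.

Lemma aut_inj (g : aut) : injective g.
Proof. by case: g => f []  /= /bij_inj. Qed.

Lemma aut_nil (g : aut) : g [::] = [::].
Proof. by case: g => f []. Qed.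

Lemma edge_rcons u x : edge u (rcons u x).
Proof. by apply/orP; left; apply/existsP; exists x. Qed.

Lemma edgeP u v :
  reflect (exists x, v = rcons u x \/ u = rcons v x) (edge u v).
Proof.
apply: (iffP orP) => [[] /existsP[x /eqP E]|[x [E|E]]]; try by exists x; auto.
- by left; apply/existsP; exists x; apply/eqP.
- by right; apply/existsP; exists x; apply/eqP.
Qed.

Lemma aut_rcons (g : aut) u x : exists y, g (rcons u x) = rcons (g u) y.
Proof.
have [_ g0 gm] := aut_funP g.
elim/last_ind: u x => [|u z IH] x.
  have := edge_rcons [::] x; rewrite -gm => /edgeP[y [->|]]; first by exists y.
  by rewrite g0; case: (g _).
have := edge_rcons (rcons u z) x; rewrite -gm => /edgeP[y [->|]].
  by exists y.
have [t ->] := IH z; move/rcons_inj => [/aut_inj + _].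
by move/(congr1 size); rewrite !size_rcons => /eqP; elim: (size u).
Qed.

Lemma is_autP f : bijective f -> f [::] = [::] ->
  (forall u x, exists y, f (rcons u x) = rcons (f u) y) -> is_aut f.
Proof.
move=> bf f0 fr; have fi := bij_inj bf; split=> // u v.
have H : forall u v y, f v = rcons (f u) y -> exists x, v = rcons u x.
  move=> {}u {}v y; case/lastP: v => [|v x]; first by rewrite f0; case: (f u).
  have [z ->] := fr v x; case/rcons_inj => /fi -> _; by exists x.
apply/edgeP/edgeP => [[y [/H|/H] [x ->]]|[x [->|->]]].
- by exists x; left.
- by exists x; right.
- by have [y ->] := fr u x; exists y; left.
- by have [y ->] := fr v x; exists y; right.
Qed.

Lemma is_aut_id : is_aut id.
Proof. by split=> //; exists id. Qed.

(* Right action: u^(gh) = (u^g)^h. *)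
Lemma is_aut_mul (g h : aut) : is_aut (h \o g).
Proof.
have [bg g0 gm] := aut_funP g; have [bh h0 hm] := aut_funP h; split.
- exact: bij_comp.
- by rewrite /= g0.
- by move=> u v; rewrite /= hm gm.
Qed.

Lemma aut_inv_subproof (g : aut) :
  exists f : word -> word, cancel f g /\ cancel g f.
Proof. by have [[f gK fK] _ _] := aut_funP g; exists f. Qed.

Definition aut_inv_fun (g : aut) := projT1 (cid (aut_inv_subproof g)).

Lemma aut_inv_funK g : cancel (aut_inv_fun g) g.
Proof. by rewrite /aut_inv_fun; case: cid => f []. Qed.

Lemma aut_funK (g : aut) : cancel g (aut_inv_fun g).
Proof. by rewrite /aut_inv_fun; case: cid => f []. Qed.

Lemma is_aut_inv g : is_aut (aut_inv_fun g).
Proof.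
have [bg g0 gm] := aut_funP g; split.
- by exists g; [exact: aut_inv_funK | exact: aut_funK].
- by rewrite -{1}g0 aut_funK.
- by move=> u v; rewrite -gm !aut_inv_funK.
Qed.

Definition aut_one := Aut is_aut_id.
Definition aut_mul g h := Aut (is_aut_mul g h).
Definition aut_inv g := Aut (is_aut_inv g).

Fact aut_mulA : associative aut_mul.
Proof. by move=> g h k; apply/autP. Qed.
Fact aut_mul1g : left_id aut_one aut_mul.
Proof. by move=> g; apply/autP. Qed.
Fact aut_mulg1 : right_id aut_one aut_mul.
Proof. by move=> g; apply/autP. Qed.
Fact aut_mulVg : left_inverse aut_one aut_inv aut_mul.
Proof. by move=> g; apply/autP => u; exact: aut_inv_funK. Qed.
Fact aut_mulgV : right_inverse aut_one aut_inv aut_mul.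
Proof. by move=> g; apply/autP => u; exact: aut_funK. Qed.

HB.instance Definition _ := isGroup.Build aut
  aut_mulA aut_mul1g aut_mulg1 aut_mulVg aut_mulgV.

Lemma aut_size (g : aut) u : size (g u) = size u.
Proof.
elim/last_ind: u => [|u x IH]; first by rewrite aut_nil.
by have [y ->] := aut_rcons g u x; rewrite !size_rcons IH.
Qed.

Definition state_fun (g : word -> word) (u w : word) := drop (size u) (g (u ++ w)).

Lemma state_funE (g : aut) u w : g (u ++ w) = g u ++ state_fun g u w.
Proof.
rewrite /state_fun; elim/last_ind: w => [|w x IH].
  by rewrite !cats0 drop_oversize ?cats0 ?aut_size.
rewrite -rcons_cat; have [y ->] := aut_rcons g (u ++ w) x.
rewrite IH; move: (drop _ _) => t.
by rewrite rcons_cat drop_size_cat ?aut_size.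
Qed.

Lemma is_aut_state (g : aut) u : is_aut (state_fun g u).
Proof.
have c (h : aut) v : cancel (state_fun h v) (state_fun h^-1 (h v)).
  move=> w; rewrite {1}/state_fun -state_funE.
  by rewrite aut_size /= aut_funK drop_size_cat.
apply: is_autP.
- exists (state_fun g^-1 (g u)); first exact: c.
  by have := c g^-1 (g u); rewrite invgK /= aut_funK.
- by rewrite /state_fun cats0 drop_oversize ?aut_size.
- move=> w x; rewrite /state_fun -rcons_cat.
  have [y ->] := aut_rcons g (u ++ w) x; exists y.
  by rewrite drop_rcons // aut_size size_cat leq_addr.
Qed.

(* g@u, determined by (uw)^g = u^g w^(g@u); see stateE. *)
Definition state (g : aut) (u : word) := Aut (is_aut_state g u).

Lemma stateE (g : aut) u w : g (u ++ w) = g u ++ state g u w.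
Proof. exact: state_funE. Qed.

(* g = (g1, g2, g3)s *)
Definition decomposes (g g1 g2 g3 : aut) (s : 'S_3) :=
  [/\ state g [:: x1] = g1, state g [:: x2] = g2, state g [:: x3] = g3
    & forall x, g [:: x] = [:: s x]].

(* The recursive automorphism acting on the first level by s, whose state at the
   letter i is itself and whose states at the other letters are trivial. *)
Fixpoint hanoi_fun (i : X) (s : 'S_3) (w : word) : word :=
  if w is x :: w' then s x :: (if x == i then hanoi_fun i s w' else w')
  else [::].

Lemma is_aut_hanoi i s : is_aut (hanoi_fun i s).
Proof.
have c j t : cancel (hanoi_fun j t) (hanoi_fun (t j) t^-1).
  elim=> [//|x w IH] /=; rewrite permK (inj_eq perm_inj).
  by case: eqP => // _; rewrite IH.
apply: is_autP => //.
- exists (hanoi_fun (s i) s^-1); first exact: c.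
  by have := c (s i) s^-1; rewrite invgK permK.
- elim=> [|z u IH] x /=; first by exists (s x); case: ifP.
  by case: ifP => _; [have [y ->] := IH x; exists y | exists x].
Qed.

Definition hanoi (i : X) (s : 'S_3) := Aut (is_aut_hanoi i s).

Definition hanoi_a := hanoi x1 (tperm x2 x3).
Definition hanoi_b := hanoi x2 (tperm x1 x3).
Definition hanoi_c := hanoi x3 (tperm x1 x2).

Lemma state_hanoi i s x : state (hanoi i s) [:: x] = if x == i then hanoi i s else 1.
Proof. by apply/autP => w; rewrite /= /state_fun /= drop0; case: eqP. Qed.

Lemma hanoi_aE : decomposes hanoi_a hanoi_a 1 1 (tperm x2 x3).
Proof. by split=> *; rewrite ?state_hanoi //= if_same. Qed.
Lemma hanoi_bE : decomposes hanoi_b 1 hanoi_b 1 (tperm x1 x3).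
Proof. by split=> *; rewrite ?state_hanoi //= if_same. Qed.
Lemma hanoi_cE : decomposes hanoi_c 1 1 hanoi_c (tperm x1 x2).
Proof. by split=> *; rewrite ?state_hanoi //= if_same. Qed.

Definition subgroup (H : set aut) : Prop := group_closed (mem H).

Definition gen (S : set aut) : set aut := smallest subgroup S.

Definition derived (G : set aut) : set aut :=
  gen [set k | exists g h, [/\ G g, G h & k = [~ g, h]]].

Definition Hanoi : set aut := gen [set hanoi_a; hanoi_b; hanoi_c].

Definition rist (G : set aut) (u : word) : set aut :=
  [set g | G g /\ forall v, ~~ prefix u v -> g v = v].

Definition rist_level (G : set aut) (n : nat) : set aut :=
  gen (\bigcup_(u in [set u : word | size u = n]) rist G u).

Definition graft_fun (u : word) (g : word -> word) (v : word) : word :=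
  if prefix u v then u ++ g (drop (size u) v) else v.

Lemma is_aut_graft u (g : aut) : is_aut (graft_fun u g).
Proof.
have c (f h : aut) : cancel f h -> cancel (graft_fun u f) (graft_fun u h).
  move=> fK v; rewrite /graft_fun; case: (boolP (prefix u v)) => [|/negPf->//].
  by case/prefixP=> w ->; rewrite prefix_prefix !drop_size_cat // fK.
apply: is_autP.
- exists (graft_fun u g^-1); apply: c; [exact: aut_funK | exact: aut_inv_funK].
- rewrite /graft_fun; case: (boolP (prefix u [::])) => //.
  by rewrite prefixs0 => /eqP ->; rewrite /= aut_nil.
- move=> v x; rewrite /graft_fun.
  case: (boolP (prefix u v)) => [/prefixP[w ->]|nv].
    rewrite rcons_cat !prefix_prefix !drop_size_cat //.
    by have [y ->] := aut_rcons g w x; exists y; rewrite rcons_cat.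
  exists x; case: (boolP (prefix u (rcons v x))) => [/prefixP[w E]|//].
  case/lastP: w E => [|w y].
    by rewrite cats0 => ->; rewrite drop_size aut_nil cats0.
  rewrite -rcons_cat => /rcons_inj[E _].
  by move: nv; rewrite E prefix_prefix.
Qed.

Definition graft (u : word) (g : aut) := Aut (is_aut_graft u g).

(* X^n * K. The factors at distinct vertices of level n commute, so the order
   in which \prod enumerates the n-tuples is irrelevant. *)
Definition graft_level (n : nat) (K : set aut) : set aut :=
  [set \prod_(u : n.-tuple X) h u
     | h in [set h : n.-tuple X -> aut | forall u : n.-tuple X, (graft u @` K) (h u)]].

(* Main.v *)
Require Import Defs.
From mathcomp Require Import all_boot all_fingroup.
From mathcomp Require Import boolp classical_sets.
From mathcomp Require Import ssralg zmodp.
Import Defs.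

(** Both groups are described by the states of their elements at level n:
    an automorphism lies in [graft_level n K] iff it fixes the vertices of
    level n and all its states there lie in [K] ([graft_levelP]).  The theorem
    thereby reduces ([rist_level_graft]) to one vertex u, u != nil:

         [graft u g] lies in Hanoi iff g lies in the commutator subgroup,

    and an induction along u ([graft_HanoiP]) reduces this to a vertex x of
    level 1.  Write G for the Hanoi group, and represent its elements by
    products of letters a, b, c.  If w is such a product, the state of w at x
    is the product of those letters of w, the section of w at x, whose loop the
    path of x under w traverses.

    From right to left the group is branch: if y, z are letters and t is the
    third one, then both y and z^t swap the two vertices other than y, the
    state of y at these is trivial while that of z^t is t, and the states at y
    are y and z.  Hence [graft [:: y] [~ y, z]] is the commutator of y and
    z^t ([graft_letterR]).  Conjugation moves this to the other vertices of
    level 1 and, since every element of G is the state at x of an element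
    that fixes x, to all conjugates of [~ y, z]; these generate the commutator
    subgroup ([derived_liftable]).

    From left to right, let the product w represent [graft [:: x] g].
    - A product of letters that represents 1 contains every letter an even
      number of times ([eval1_even]).  This holds for its sections, which also
      represent 1, by induction on the length, and the letters of the sections
      at the three vertices together are those of w.  Only the powers of a
      letter have a section of the same length, and these are settled by the
      action on level 1.
    - Let e_1, e_2, e_3 be the classes of a, b, c in (Z/2)^3 modulo the class of
      abc, so that e_1 + e_2 + e_3 = 0.  Then the class of the section of w at
      i is the class of w plus e_i plus e_(w(i)) ([sect_cocycle]).  For i != x
      the state of [graft [:: x] g] is trivial and w(i) = i, so the class of w
      is 0: the three letters occur in w with the same parity.
    - That parity is even, since w acts trivially on level 1 and therefore has
      even length.  The section at x, which represents g, has the letter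
      parities of w, as the two other sections have even ones.
    So g is represented by a product in which every letter occurs an even number
    of times, and such a product lies in the commutator subgroup
    ([even_derived]). *)

Set Implicit Arguments.
Unset Strict Implicit.
Unset Printing Implicit Defensive.

Local Open Scope classical_set_scope.
Local Open Scope group_scope.

(** * Subgroups and commutator subgroups *)

Section Subgroups.
Implicit Types (S H : set aut) (g h k : aut).

Lemma subgroupP H :
  subgroup H <-> H 1 /\ forall g h, H g -> H h -> H (g * h^-1).
Proof.
split=> [[H1 HD]|[H1 HD]]; split.
- by move/set_mem: H1.
- by move=> g h gH hH; apply/set_mem/HD; apply/mem_set.
- exact/mem_set.
- by move=> g h /set_mem gH /set_mem hH; apply/mem_set/HD.
Qed.

Section Closure.
Variables (H : set aut) (sgH : subgroup H).

Lemma subgroup1 : H 1.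
Proof. by have [] := (subgroupP H).1 sgH. Qed.

Lemma subgroupV g : H g -> H g^-1.
Proof.
have [H1 HD] := (subgroupP H).1 sgH.
by move=> gH; rewrite -[g^-1]mul1g; exact: HD.
Qed.

Lemma subgroupM g h : H g -> H h -> H (g * h).
Proof.
have [H1 HD] := (subgroupP H).1 sgH.
by move=> gH hH; rewrite -[h]invgK; apply/HD => //; exact: subgroupV.
Qed.

Lemma subgroupJ g h : H g -> H h -> H (g ^ h).
Proof. by move=> *; rewrite conjgE; do !apply: subgroupM => //; exact: subgroupV. Qed.

Lemma subgroupR g h : H g -> H h -> H [~ g, h].
Proof. by move=> *; apply: subgroupM; [exact: subgroupV|exact: subgroupJ]. Qed.

End Closure.

Lemma gen_subgroup S : subgroup (gen S).
Proof.
apply/subgroupP; split=> [H [sgH _]|g h gS hS H HS]; first exact: subgroup1.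
have [sgH _] := HS.
by have [_ HD] := (subgroupP H).1 sgH; apply: HD; [exact: gS|exact: hS].
Qed.

Lemma sub_gen S : S `<=` gen S.
Proof. by move=> g gS H [_]; apply. Qed.

Lemma gen_sub S H : subgroup H -> S `<=` H -> gen S `<=` H.
Proof. by move=> sgH SH g; apply. Qed.

Lemma derived_sub S : subgroup S -> derived S `<=` S.
Proof.
by move=> sgS; apply: gen_sub => // _ [g [h [gS hS ->]]]; exact: subgroupR.
Qed.

Lemma derivedR S g h : S g -> S h -> derived S [~ g, h].
Proof. by move=> gS hS; apply: sub_gen; exists g, h. Qed.

Lemma derivedJ S g h : subgroup S -> derived S g -> S h -> derived S (g ^ h).
Proof.
move=> sgS gS hS.
apply: (gen_sub (H := [set k | derived S (k ^ h)])) gS => /=.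
  have sgD : subgroup (derived S) by exact: gen_subgroup.
  apply/subgroupP; split=> [|k l kS lS] /=.
    by rewrite conj1g; exact: (subgroup1 sgD).
  by rewrite conjMg conjVg; apply: (subgroupM sgD) => //; exact: (subgroupV sgD).
by move=> _ [k [l [kS lS ->]]] /=; rewrite conjRg; apply: derivedR; exact: subgroupJ.
Qed.

End Subgroups.

(** * States and grafts *)

Section Tree.
Implicit Types (u v w : word) (g h k : aut).

Lemma autM g h u : (g * h) u = h (g u).
Proof. by []. Qed.

(** The action on deep words determines the action on their prefixes, so short
    words can be ignored. *)
Lemma aut_ext n g h :
  (forall v w, size v = n -> g (v ++ w) = h (v ++ w)) -> g = h.
Proof.
move=> E; apply/autP => v.
have Ev w : (n <= size w)%N -> g w = h w.
  by move=> nw; rewrite -(cat_take_drop n w) E // size_takel.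
have := Ev (v ++ nseq n x1); rewrite size_cat size_nseq leq_addl => /(_ isT).
rewrite !stateE => /eqP; rewrite eqseq_cat ?aut_size //.
by case/andP => /eqP.
Qed.

Lemma stateP g v k :
  (forall w, g (v ++ w) = v ++ k w) -> g v = v /\ state g v = k.
Proof.
move=> E; have gv : g v = v by have := E [::]; rewrite aut_nil !cats0.
split=> //; apply/autP => w; have := E w; rewrite stateE gv.
by move/eqP; rewrite eqseq_cat // => /andP[_ /eqP].
Qed.

Lemma state1 v : state 1 v = 1.
Proof. by have [] := @stateP 1 v 1. Qed.

Lemma stateM g h v : state (g * h) v = state g v * state h (g v).
Proof.
apply/autP => w; have := stateE (g * h) v w.
by rewrite !autM !stateE => /eqP; rewrite eqseq_cat // eqxx => /eqP.
Qed.

Lemma graft_in u k w : graft u k (u ++ w) = u ++ k w.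
Proof. by rewrite /= /graft_fun prefix_prefix drop_size_cat. Qed.

Lemma graft_out u k v : ~~ prefix u v -> graft u k v = v.
Proof. by rewrite /= /graft_fun => /negPf ->. Qed.

Lemma graftM u g h : graft u (g * h) = graft u g * graft u h.
Proof.
apply/autP => v; rewrite autM; have [/prefixP[w ->]|nuv] := boolP (prefix u v).
  by rewrite !graft_in.
by rewrite !graft_out.
Qed.

Lemma graft1 u : graft u 1 = 1.
Proof. by apply: (mulgI (graft u 1)); rewrite -graftM !mulg1. Qed.

Lemma graftV u g : graft u g^-1 = (graft u g)^-1.
Proof. by apply: (mulgI (graft u g)); rewrite -graftM !mulgV graft1. Qed.

Lemma graft0 k : graft [::] k = k.
Proof. by apply/autP => v; rewrite (graft_in [::]). Qed.

Lemma graft_cons x u k : graft (x :: u) k = graft [:: x] (graft u k).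
Proof.
apply/autP => -[|y v]; rewrite /= /graft_fun //= prefix0s andbT drop0.
by case: eqP => //= ->; rewrite /graft_fun; case: ifP.
Qed.

Lemma prefix_eqsize u v w : size u = size v -> prefix u (v ++ w) = (u == v).
Proof. by move=> uv; rewrite prefixE take_size_cat // eq_sym. Qed.

Lemma graftJ u k g : graft u k ^ g = graft (g u) (k ^ state g u).
Proof.
apply: (mulgI g); rewrite -conjgC; apply: (@aut_ext (size u)) => v w vu.
rewrite !autM [g (v ++ w)]stateE.
have [<-|nuv] := eqVneq u v.
  by rewrite !graft_in stateE -autM conjgC.
by rewrite !graft_out ?stateE // prefix_eqsize ?aut_size // (inj_eq (@aut_inj g)).
Qed.

End Tree.

(** * Level stabilizers and the reduction to one vertex *)

Section Levels.
Variable n : nat.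
Implicit Types (K : set aut) (v w : word).

Lemma prod_graftE (k : n.-tuple X -> aut) (r : seq (n.-tuple X)) (v : n.-tuple X) w :
  uniq r ->
  (\prod_(u <- r) graft u (k u)) (v ++ w) = v ++ (if v \in r then k v w else w).
Proof.
elim: r w => [|u r IH] w /=; first by rewrite big_nil.
case/andP => ur ruq; rewrite big_cons autM inE.
have [vu|nvu] := eqVneq v u.
  by subst u; rewrite graft_in IH // (negPf ur).
by rewrite graft_out ?IH // prefix_eqsize ?size_tuple // eq_sym.
Qed.

(** This description does not mention the order of the factors, so products
    in [graft_level n K] can be computed state by state. *)
Lemma graft_levelP K g :
  graft_level n K g <->
  forall v, size v = n -> g v = v /\ K (state g v).
Proof.
split=> [[h hP <-] v /eqP vn|gP].
  have /choice[k kP] : forall u : n.-tuple X, exists k, K k /\ graft u k = h u.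
    by move=> u; have [k] := hP u; exists k.
  have [E1 E2] : (\prod_u h u) v = v /\ state (\prod_u h u) v = k (Tuple vn).
    apply: stateP => w; under eq_bigr => u _ do rewrite -(kP u).2.
    by rewrite (prod_graftE k (Tuple vn)) ?index_enum_uniq // mem_index_enum.
  by rewrite E2; split=> //; have [] := kP (Tuple vn).
exists (fun u => graft u (state g u)).
  by move=> u /=; exists (state g u) => //; have [] := gP u (size_tuple u).
apply: (@aut_ext n) => v w vn; move/eqP: (vn) => vt.
rewrite (prod_graftE (fun u => state g u) (Tuple vt)) ?index_enum_uniq //.
by rewrite mem_index_enum /= stateE; have [->] := gP v vn.
Qed.

Lemma graft_level_subgroup K : subgroup K -> subgroup (graft_level n K).
Proof.
move=> sgK; apply/subgroupP; split=> [|g h /graft_levelP gP /graft_levelP hP].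
  by apply/graft_levelP => v _; rewrite state1; split=> //; exact: subgroup1.
apply/graft_levelP => v vn; have [gv gK] := gP v vn; have [hv hK] := hP v vn.
have hVv : h^-1 v = v by rewrite -{1}hv -autM mulgV.
rewrite autM gv stateM gv; split=> //; apply: subgroupM => //.
have : state h v * state h^-1 v = 1 by rewrite -{2}hv -stateM mulgV state1.
by move/mulg1_eq <-; exact: subgroupV.
Qed.

(** An element of the rigid stabilizer of u fixes every vertex of level n other
    than u, hence u as well by injectivity; so it is the graft at u of its state
    at u. *)
Lemma rist_level_graft G :
  subgroup G ->
  (forall u g, size u = n -> (G (graft u g) <-> derived G g)) ->
  rist_level G n = graft_level n (derived G).
Proof.
move=> sgG GP; have sgD : subgroup (derived G) by exact: gen_subgroup.
apply/seteqP; split=> g.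
  apply: gen_sub; first exact: graft_level_subgroup.
  move=> {}g [u /= un [gG gfix]].
  have fixv v w : size v = n -> v != u -> g (v ++ w) = v ++ w.
    by move=> vn vu; apply: gfix; rewrite prefix_eqsize 1?eq_sym ?un.
  (* If g u were another vertex of level n, g would fix it and map u to it. *)
  have gu : g u = u.
    apply/eqP; apply: contraT => gu; have := fixv (g u) [::].
    by rewrite cats0 aut_size => /(_ un gu) /aut_inj E; rewrite E eqxx in gu.
  have gE : g = graft u (state g u).
    apply: (@aut_ext n) => v w vn; have [->|vu] := eqVneq v u.
      by rewrite graft_in stateE gu.
    by rewrite fixv // graft_out // prefix_eqsize 1?eq_sym ?un.
  apply/graft_levelP => v vn; have [->|vu] := eqVneq v u.
    by split=> //; apply/(GP u) => //; rewrite -gE.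
  have [-> ->] := stateP (k := 1) (fun w => fixv v w vn vu).
  by split=> //; exact: subgroup1.
case=> h hP <-; apply: big_ind => [|a b|u _].
- apply: subgroup1; exact: gen_subgroup.
- apply: subgroupM; exact: gen_subgroup.
have [k kG <-] := hP u; apply: sub_gen; exists u; first exact: size_tuple.
split=> [|v]; last exact: graft_out.
by apply/GP; rewrite ?size_tuple.
Qed.

End Levels.
(** * Products of letters and their sections *)

Section Letters.
Implicit Types (x y z i : X) (v w : word).

Lemma letterP x : [\/ x = x1, x = x2 | x = x3].
Proof.
case: x => [[|[|[|//]]] lt3]; [constructor 1|constructor 2|constructor 3];
  exact/val_inj.
Qed.

(** The action of the letter z on level 1, with the letters 1, 2, 3 read in
    Z/3: the fixed point is z since 3 z = 0, and the two other elements are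
    swapped since the three elements of Z/3 add up to 0. *)
Definition move (z x : X) : X := (- (x + z))%R.

Lemma move_table :
  ((move x1 x1 = x1) * (move x1 x2 = x3) * (move x1 x3 = x2) *
   (move x2 x1 = x3) * (move x2 x2 = x2) * (move x2 x3 = x1) *
   (move x3 x1 = x2) * (move x3 x2 = x1) * (move x3 x3 = x3))%type.
Proof. by do !split; exact/val_inj. Qed.

Lemma moveK z : involutive (move z).
Proof. by move=> x; rewrite /move GRing.opprD GRing.opprK GRing.addrK. Qed.

Lemma move_fixed z x : (move z x == z) = (x == z).
Proof. by case: (letterP x) => ->; case: (letterP z) => ->. Qed.

Definition move_perm z : 'S_3 := perm (can_inj (moveK z)).

(** Indexing the three generators by the letter that they fix makes the
    symmetry between them available. *)
Definition letter z : aut := hanoi z (move_perm z).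

Lemma letterE z x v :
  letter z (x :: v) = move z x :: (if x == z then letter z v else v).
Proof. by rewrite /= permE. Qed.

Lemma letter_abc :
  [/\ letter x1 = hanoi_a, letter x2 = hanoi_b & letter x3 = hanoi_c].
Proof.
by split; congr hanoi; apply/permP => x; rewrite permE;
  case: (letterP x) => ->; rewrite permE; exact/val_inj.
Qed.

Lemma letterK z : letter z * letter z = 1.
Proof.
apply/autP; elim=> // x v IH; rewrite autM !letterE moveK move_fixed.
by case: eqP => // _; rewrite -autM IH.
Qed.

Lemma letterV z : (letter z)^-1 = letter z.
Proof. exact/mulg1_eq/letterK. Qed.

(** The [word] argument lists generators here, and is not a vertex. *)
Fixpoint eval w : aut := if w is z :: w' then letter z * eval w' else 1.

Lemma eval_cat v w : eval (v ++ w) = eval v * eval w.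
Proof. by elim: v => [|z v IH] /=; rewrite ?mul1g // IH mulgA. Qed.

Lemma eval_rev w : eval (rev w) = (eval w)^-1.
Proof.
elim: w => [|z w IH] /=; first by rewrite invg1.
by rewrite rev_cons -cats1 eval_cat IH /= mulg1 invgM letterV.
Qed.

Lemma HanoiP g : Hanoi g <-> exists w, g = eval w.
Proof.
have [Ea Eb Ec] := letter_abc; split=> [|[w ->]].
  apply: (gen_sub (H := [set g | exists w, g = eval w])) => {g} [|g /=].
    apply/subgroupP; split=> [|g h [v ->] [w ->]]; first by exists [::].
    by exists (v ++ rev w); rewrite eval_cat eval_rev.
  rewrite -Ea -Eb -Ec => -[[]|] ->; [exists [:: x1]|exists [:: x2]|exists [:: x3]];
    by rewrite /= mulg1.
have sgH : subgroup Hanoi by exact: gen_subgroup.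
elim: w => [|z w IH] /=; first exact: (subgroup1 sgH).
apply: (subgroupM sgH) IH; apply: sub_gen; rewrite /= -Ea -Eb -Ec.
by case: (letterP z) => ->; [left; left|left; right|right].
Qed.

Lemma eval_Hanoi w : Hanoi (eval w).
Proof. by apply/HanoiP; exists w. Qed.

Lemma letter_Hanoi z : Hanoi (letter z).
Proof. by have := eval_Hanoi [:: z]; rewrite /= mulg1. Qed.

(** [act x w] is the end of the path of x under w, and [sect x w] lists the loops
    traversed on the way: [state_eval] makes it a product for the state at x. *)
Fixpoint act x w : X := if w is z :: w' then act (move z x) w' else x.

Fixpoint sect x w : word :=
  if w is z :: w' then
    if x == z then z :: sect (move z x) w' else sect (move z x) w'
  else [::].

Lemma evalE x w v : eval w (x :: v) = act x w :: eval (sect x w) v.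
Proof.
elim: w x v => [//|z w IH] x v; rewrite /= -/eval permE.
by rewrite IH; case: eqP.
Qed.

Lemma state_eval x w : state (eval w) [:: x] = eval (sect x w).
Proof.
apply/autP => v; have := stateE (eval w) [:: x] v; rewrite cat1s !evalE aut_nil.
by case.
Qed.

(** Each letter acts on Z/3 as x -> - x + const, so the linear part of a product is
    given by the parity of its length. *)
Lemma act_affine x w :
  act x w = ((if odd (size w) then - x else x) + act 0%R w)%R.
Proof.
elim: w x => [|z w IH] x /=; first by rewrite GRing.addr0.
rewrite IH (IH (move z 0)%R) /move GRing.add0r; case: (odd _) => /=.
  by rewrite !GRing.opprK GRing.addrA.
by rewrite GRing.opprD GRing.addrA.
Qed.

Lemma act_id_even w : (forall x, act x w = x) -> ~~ odd (size w).
Proof.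
(* An odd w that fixes 0 acts as x -> - x, which moves 1. *)
move=> actw; have := act_affine 1%R w; rewrite !actw GRing.addr0.
by case: odd.
Qed.

(** Each letter of w is a loop for exactly one of the three paths under w. *)
Lemma count_sect (a : pred X) w :
  count a w = (\sum_(x : X) count a (sect x w))%N.
Proof.
elim: w => [|z w IH] /=; first by rewrite big1.
rewrite (reindex_inj (inv_inj (moveK z))) /= in IH.
rewrite IH (bigD1 z) //= [RHS](bigD1 z) //= eqxx /= -addnA; congr (_ + (_ + _))%N.
by apply: eq_bigr => x /negPf ->.
Qed.

(** The contraction of the length, with its equality case: w stays in the loop
    at x. *)
Lemma sect_size x w : size (sect x w) <= size w ?= iff (w == nseq (size w) x).
Proof.
elim: w x => [//|z w IH] x /=; rewrite eqseq_cons eq_sym.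
have [<-|_] := eqVneq x z.
  have -> : move x x = x by apply/eqP; rewrite move_fixed.
  by have [le_s eq_s] := IH x; split.
have [le_s _] := IH (move z x); split; first exact: leqW.
by apply/negbTE; rewrite neq_ltn ltnS le_s.
Qed.

Lemma eval_eq1 w : eval w = 1 ->
  forall x, act x w = x /\ eval (sect x w) = 1.
Proof.
move=> w1 x; rewrite -state_eval w1 state1; split=> //.
by have := evalE x w [::]; rewrite w1 => -[].
Qed.

(** * Parities of letters *)

Definition even_letters w := forall y, ~~ odd (count_mem y w).

Lemma odd_sum (P : pred X) (F : X -> nat) :
  (forall x, P x -> ~~ odd (F x)) -> ~~ odd (\sum_(x | P x) F x)%N.
Proof.
by move=> eF; elim/big_ind: _ => // m n em en; rewrite oddD (negPf em) (negPf en).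
Qed.

(** The parity of a letter is a well-defined function on the Hanoi group.  By
    induction on the length, the sections of w have this property unless w is
    a power of a letter, which is trivial on level 1 only if its exponent is
    even. *)
Lemma eval1_even w : eval w = 1 -> even_letters w.
Proof.
have [n] := ubnP (size w); elim: n w => // n IH w; rewrite ltnS => wn w1 y.
have w1x := eval_eq1 w1.
have [/existsP[x /eqP wE]|/existsPn wN] := boolP [exists x, w == nseq (size w) x].
  rewrite wE count_nseq /=; case: eqP => _; rewrite ?mul0n // mul1n.
  by apply: act_id_even => z; have [] := w1x z.
rewrite count_sect; apply: odd_sum => x _; apply: IH; last by have [] := w1x x.
by apply: leq_trans wn; rewrite (ltn_leqif (sect_size x w)).
Qed.

(** An equality of parity vectors up to a constant vector [b] is an equality
    modulo the class of abc.  The formula e_i + e_(w(i)) is a coboundary, so it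
    is additive along the path of i, and only single letters must be checked:
    a loop gives e_z + e_z + 0, a move i -> j under z gives 0 + e_z + e_i + e_j,
    which is 0 because i, j, z are the three letters. *)
Lemma sect_cocycle i w : exists b : bool, forall y,
  odd (count_mem y (sect i w)) =
  odd (count_mem y w) (+) (y == i) (+) (y == act i w) (+) b.
Proof.
elim: w i => [|z w IH] i /=; first by exists false => y; rewrite addbF addbb.
have [b bE] := IH (move z i); exists (b (+) (i != z)) => y.
have -> : odd (count_mem y (if i == z then z :: sect (move z i) w
            else sect (move z i) w)) =
          ((i == z) && (z == y)) (+) odd (count_mem y (sect (move z i) w)).
  by case: eqP => //= _; rewrite oddD oddb.
rewrite bE oddD oddb.
have -> : (i == z) && (z == y) =
    (z == y) (+) (y == i) (+) (y == move z i) (+) (i != z).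
  by case: (letterP i) => ->; case: (letterP z) => ->; case: (letterP y) => ->.
by clear bE; do !case: (_ == _) => //; case: odd; case: b.
Qed.

(** Parities cannot be read off [g] alone: the constraint comes from the two
    trivial states beside it. *)
Lemma graft_sect_even x g w : graft [:: x] g = eval w -> even_letters (sect x w).
Proof.
move=> gw.
have actw i : act i w = i.
  have := evalE i w [::]; rewrite -gw /= /graft_fun /=.
  by case: ifP => [/andP[/eqP -> _]|_] [].
have off y i : i != x -> ~~ odd (count_mem y (sect i w)).
  move=> ix; apply: eval1_even; rewrite -state_eval -gw.
  have [] // := @stateP (graft [:: x] g) [:: i] 1 => v.
  by rewrite graft_out //= eq_sym (negPf ix).
have inx y : odd (count_mem y (sect x w)) = odd (count_mem y w).
  rewrite [in RHS]count_sect (bigD1 x) //= oddD.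
  suff /negPf -> : ~~ odd (\sum_(i : X | i != x) count_mem y (sect i w))%N.
    by rewrite addbF.
  by apply: odd_sum => i; exact: off.
(* The cocycle at a vertex off x: all letters have the same parity [b] in w. *)
have [i ix] : exists i, i != x.
  by case: (letterP x) => ->; [exists x2|exists x1|exists x1].
have [b bE] := sect_cocycle i w.
have wb y : odd (count_mem y w) = b.
  have := bE y; rewrite actw (negPf (off y i ix)) addbK.
  by clear bE; case: odd; case: b.
(* The length of w is even and congruent to 3 b. *)
have : ~~ odd (size w) by exact: act_id_even.
have -> : size w = (\sum_(y : X) count_mem y w)%N.
  elim: (w) => [|z v IHv] /=; first by rewrite big1.
  rewrite big_split /= -IHv (bigD1 z) //= eqxx big1 // => y.
  by rewrite eq_sym => /negPf ->.
rewrite !big_ord_recl big_ord0 !oddD !wb => eb y; rewrite inx wb.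
by move: eb; clear; case: b.
Qed.

(** Remove letters by pairs: z u z v = [z, u^-1] u v when z is an involution. *)
Lemma even_derived w : even_letters w -> derived Hanoi (eval w).
Proof.
have sgD : subgroup (derived Hanoi) by exact: gen_subgroup.
have [n] := ubnP (size w); elim: n w => // n IH [|z w] /=.
  by move=> _ _; exact: (subgroup1 sgD).
rewrite ltnS => wn ew.
have : z \in w.
  by have := ew z; rewrite /= eqxx; apply: contraNT => /count_memPn ->.
move=> zw; case/splitPr: zw wn ew => u v wn ew.
have -> : letter z * eval (u ++ z :: v) =
    [~ letter z, (eval u)^-1] * eval (u ++ v).
  by rewrite !eval_cat /= commgEl conjgE letterV invgK !mulgA mulgKV.
apply: (subgroupM sgD).
  apply: derivedR; first exact: letter_Hanoi.
  by rewrite -eval_rev; exact: eval_Hanoi.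
apply: IH => [|y]; first by move: wn; rewrite !size_cat /= addnS => /ltnW.
have := ew y; rewrite /= !count_cat /= !oddD.
by case: (z == y) => //=; case: odd; case: odd.
Qed.

Lemma graft1_derived x g : Hanoi (graft [:: x] g) -> derived Hanoi g.
Proof.
case/HanoiP => w gw; have [_ gE] := stateP (graft_in [:: x] g).
by rewrite -gE gw state_eval; apply: even_derived; exact: graft_sect_even gw.
Qed.

(** * Grafts of commutators at level 1 *)

(** With t the third letter, y = (y, 1, 1) s and z^t = (z, t, t) s, where the
    first coordinate is that of the vertex y and s swaps the other two.  The
    states off y commute, so only the coordinate y of the commutator
    survives.  If z = y, both sides are 1. *)
Lemma graft_letterR y z :
  graft [:: y] [~ letter y, letter z] =
  [~ letter y, letter z ^ letter (move z y)].
Proof.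
have letterKl t g : letter t * (letter t * g) = g by rewrite mulgA letterK mul1g.
set t := move z y; have -> : [~ letter y, letter z ^ letter t] =
    eval [:: y; t; z; t; y; t; z; t].
  by rewrite /= commgEl !conjgE !invMg !letterV mulg1 !mulgA.
apply/autP => -[|x v]; first by rewrite !aut_nil.
rewrite evalE.
have -> : act x [:: y; t; z; t; y; t; z; t] = x.
  by rewrite /t; case: (letterP x) => ->; case: (letterP y) => ->;
    case: (letterP z) => ->; exact/val_inj.
have -> : eval (sect x [:: y; t; z; t; y; t; z; t]) =
    if x == y then [~ letter y, letter z] else 1.
  rewrite commgEl conjgE !letterV.
  by rewrite /t; case: (letterP x) => ->; case: (letterP y) => ->;
    case: (letterP z) => ->; rewrite ?move_table /= ?move_table /= ?mulg1;
    do ?rewrite letterKl; do ?rewrite letterK.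
have [->|nxy] := eqVneq x y; first by rewrite (graft_in [:: y]).
by rewrite graft_out //= eq_sym (negPf nxy).
Qed.

Let sgH : subgroup Hanoi. Proof. exact: gen_subgroup. Qed.
Let sgD : subgroup (derived Hanoi). Proof. exact: gen_subgroup. Qed.

Definition liftable : set aut :=
  [set k | forall x, derived Hanoi (graft [:: x] k)].

Lemma liftable_subgroup : subgroup liftable.
Proof.
apply/subgroupP; split=> [x|g h gL hL x]; first by rewrite graft1; exact: (subgroup1 sgD).
by rewrite graftM graftV; apply: (subgroupM sgD) => //; exact: (subgroupV sgD).
Qed.

(** The group is self-replicating: if the letter y takes x to z, then under
    the product y z y the path of x goes to z, through the loop z, and back.
    Conjugating a graft at x by this product conjugates the grafted element
    by z. *)
Lemma liftableJ g h : liftable g -> Hanoi h -> liftable (g ^ h).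
Proof.
move=> gL /HanoiP[w ->]; elim: w g gL => [|z w IH] g gL /=; first by rewrite conjg1.
rewrite conjgM; apply: IH => x.
set y := move z x; pose l := eval [:: y; z; y].
have lx : l [:: x] = [:: x].
  rewrite /l evalE aut_nil; congr [:: _].
  by rewrite /y; case: (letterP x) => ->; case: (letterP z) => ->; exact/val_inj.
have ls : state l [:: x] = letter z.
  rewrite /l state_eval /y.
  by case: (letterP x) => ->; case: (letterP z) => ->;
    rewrite ?move_table /= ?move_table /= ?mulg1 ?letterK ?mulg1.
have := derivedJ sgH (gL x) (eval_Hanoi [:: y; z; y]).
by rewrite graftJ -/l lx ls.
Qed.

(** [graft_letterR] covers the vertex y; the letter that swaps x and y has a
    trivial state at y, and moves the graft to x unchanged. *)
Lemma liftable_letterR y z : liftable [~ letter y, letter z].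
Proof.
have base i j : derived Hanoi (graft [:: i] [~ letter i, letter j]).
  rewrite graft_letterR; apply: derivedR; first exact: letter_Hanoi.
  by apply: (subgroupJ sgH); exact: letter_Hanoi.
move=> x; have [->|nxy] := eqVneq x y; first exact: base.
have := derivedJ sgH (base y z) (letter_Hanoi (move x y)).
have my : (y == move x y) = false.
  by move: nxy; case: (letterP x) => ->; case: (letterP y) => ->.
have mx : move (move x y) y = x.
  by case: (letterP x) => ->; case: (letterP y) => ->; exact/val_inj.
have := state_eval y [:: move x y]; rewrite /= mulg1 my => sy.
by rewrite graftJ letterE my mx sy conjg1.
Qed.

(** As [liftable] is stable under conjugation, commuting with a given element
    modulo [liftable] is preserved by products; applied to each argument of
    the commutator, this leaves pairs of generators. *)
Lemma derived_liftable : derived Hanoi `<=` liftable.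
Proof.
have sgL := liftable_subgroup.
have lR h : (forall z, liftable [~ letter z, h]) ->
    forall w, liftable [~ eval w, h].
  move=> Lh; elim=> [|z w IH] /=; first by rewrite comm1g; exact: (subgroup1 sgL).
  have -> : [~ letter z * eval w, h] = [~ letter z, h] ^ eval w * [~ eval w, h].
    by rewrite !commgEl !conjgE invMg !mulgA !mulgK.
  by apply: (subgroupM sgL) => //; apply: liftableJ => //; exact: eval_Hanoi.
apply: gen_sub; first exact: liftable_subgroup.
move=> _ [_ [_ [/HanoiP[u ->] /HanoiP[v ->] ->]]]; apply: (lR) => z.
rewrite -invgR; apply: (subgroupV sgL); apply: lR => y.
exact: liftable_letterR.
Qed.

(** A nonempty u is needed: at the root the left side only says that g is in the
    group.  The commutator subgroup being contained in the group, the case of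
    level 1 can be iterated. *)
Lemma graft_HanoiP u g : (0 < size u)%N ->
  Hanoi (graft u g) <-> derived Hanoi g.
Proof.
move=> u_gt0; split; last first.
  move=> gD; apply: (derived_sub sgH); elim: u {u_gt0} => [|x u IH].
    by rewrite graft0.
  by rewrite graft_cons; exact: derived_liftable.
elim: u g u_gt0 => // x u IH g _; rewrite graft_cons => /graft1_derived.
case: u IH => [|y u] IH; first by rewrite graft0.
by move/(derived_sub sgH)/IH; apply.
Qed.

End Letters.

Theorem lemma4 : forall n : nat, (1 <= n)%N ->
  rist_level Hanoi n = graft_level n (derived Hanoi).
Proof.
move=> n n_gt0; apply: rist_level_graft; first exact: gen_subgroup.
by move=> u g un; apply: graft_HanoiP; rewrite un.
Qed.
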